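(* Let $(\mathbf{d}^-,\mathbf{d}^+)\neq\mathbf{0}$ be an orientation, with $\mathbf{d}^-\in\mathbb{R}^m$, $\mathbf{d}^+\in\mathbb{R}^s$ non-negative, and let $\beta^*(\mathbf{x},\mathbf{y})$ be a function on $P$ defined by $\beta^*_{\mathrm{L}}(\mathbf{x},\mathbf{y})$ or $\beta^*_{\mathrm{Q}}(\mathbf{x},\mathbf{y})$, as given in the context. Then $$\frac{\partial \beta^*}{\partial x_i}(\mathbf{x},\mathbf{y})\geq 0\qquad\text{and}\qquad \frac{\partial \beta^*}{\partial y_r}(\mathbf{x},\mathbf{y})\leq 0$$ for $i=1,\ldots,m$ and $r=1,\ldots,s$.
   Context: Fix positive integers $m,s,n$ and strictly positive data matrices $X=(x_{ij})\in\mathbb{R}_{>0}^{m\times n}$, $Y=(y_{rj})\in\mathbb{R}_{>0}^{s\times n}$ (inputs and outputs of $n$ reference decision-making units, DMUs). Inequalities between vectors are component-wise. The production possibility set under constant returns to scale is $$P=\{(\mathbf{x},\mathbf{y})\in\mathbb{R}_{>0}^{m+s} : X\boldsymbol{\lambda}\le \mathbf{x},\ \mathbf{y}\le Y\boldsymbol{\lambda}\text{ for some }\boldsymbol{\lambda}\in\mathbb{R}^n,\ \boldsymbol{\lambda}\ge\mathbf{0}\}.$$ For $(\mathbf{x},\mathbf{y})\in P$ define: (Linear oriented model) $\beta^*_{\mathrm{L}}(\mathbf{x},\mathbf{y})$ is the maximum of $\beta$ over all $\beta\ge 0$, $\boldsymbol{\lambda}\ge\mathbf{0}$ with $\sum_{j=1}^n\lambda_jx_{ij}-(1-\beta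 d^-_i)x_i\le 0$ for $i=1,\ldots,m$ and $\sum_{j=1}^n\lambda_jy_{rj}-(1+\beta d^+_r)y_r\ge 0$ for $r=1,\ldots,s$. (Quadratic-CRS oriented model) $\beta^*_{\mathrm{Q}}(\mathbf{x},\mathbf{y})$ is the maximum of $\beta$ over all $\beta\ge 0$, $\boldsymbol{\lambda}\ge\mathbf{0}$ with $\beta d^+_r<1$ for $r=1,\ldots,s$, $\sum_{j=1}^n\lambda_jx_{ij}-(1-\beta d^-_i)x_i\le 0$ for $i=1,\ldots,m$ and $\sum_{j=1}^n\lambda_jy_{rj}-\frac{1}{1-\beta d^+_r}\,y_r\ge 0$ for $r=1,\ldots,s$.
   Formalization: The sign of each partial derivative of β* is asserted only at points of P where that partial derivative exists, since β* is not differentiable everywhere on P (e.g. β*_L = 1 − y/min(x₁,x₂) at x₁ = x₂). *)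

(* Defs.v *)
From mathcomp Require Import all_boot all_order all_algebra.
From mathcomp Require Import all_classical all_reals all_analysis.

Set Implicit Arguments.
Unset Strict Implicit.
Unset Printing Implicit Defensive.

Import Order.TTheory GRing.Theory Num.Theory.
Import numFieldNormedType.Exports.

Local Open Scope classical_set_scope.
Local Open Scope ring_scope.

Definition is_maximum (R : realType) (A : set R) (b : R) : Prop :=
  A b /\ ubound A b.

(* A junk value when [A] has no maximum; [betaL_is_maximum] and
   [betaQ_is_maximum] below show that this never happens on the production
   possibility set. *)
Definition maximum (R : realType) (A : set R) : R := get (is_maximum A).

Definition production_set (R : realType) (m s n : nat)
    (X : 'M[R]_(m, n)) (Y : 'M[R]_(s, n)) : set ('cV[R]_m * 'cV[R]_s) :=
  [set z : 'cV[R]_m * 'cV[R]_s |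
          [/\ forall i, 0 < z.1 i 0,
               forall r, 0 < z.2 r 0
             & exists lam : 'cV[R]_n,
                 [/\ forall j, 0 <= lam j 0,
                     forall i, (X *m lam) i 0 <= z.1 i 0
                   & forall r, z.2 r 0 <= (Y *m lam) r 0]]].

Definition feasibleL (R : realType) (m s n : nat)
    (X : 'M[R]_(m, n)) (Y : 'M[R]_(s, n)) (dm : 'cV[R]_m) (dp : 'cV[R]_s)
    (z : 'cV[R]_m * 'cV[R]_s) : set R :=
  [set b : R | 0 <= b /\
     exists lam : 'cV[R]_n,
       [/\ forall j, 0 <= lam j 0,
           forall i,
             \sum_(j < n) lam j 0 * X i j - (1 - b * dm i 0) * z.1 i 0 <= 0
         & forall r,
             \sum_(j < n) lam j 0 * Y r j - (1 + b * dp r 0) * z.2 r 0 >= 0]].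

Definition feasibleQ (R : realType) (m s n : nat)
    (X : 'M[R]_(m, n)) (Y : 'M[R]_(s, n)) (dm : 'cV[R]_m) (dp : 'cV[R]_s)
    (z : 'cV[R]_m * 'cV[R]_s) : set R :=
  [set b : R | 0 <= b /\
     exists lam : 'cV[R]_n,
       [/\ forall j, 0 <= lam j 0,
           forall r, b * dp r 0 < 1,
           forall i,
             \sum_(j < n) lam j 0 * X i j - (1 - b * dm i 0) * z.1 i 0 <= 0
         & forall r,
             \sum_(j < n) lam j 0 * Y r j - (1 - b * dp r 0)^-1 * z.2 r 0
               >= 0]].

Definition betaL (R : realType) (m s n : nat)
    (X : 'M[R]_(m, n)) (Y : 'M[R]_(s, n)) (dm : 'cV[R]_m) (dp : 'cV[R]_s)
    (z : 'cV[R]_m * 'cV[R]_s) : R :=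
  maximum (feasibleL X Y dm dp z).

Definition betaQ (R : realType) (m s n : nat)
    (X : 'M[R]_(m, n)) (Y : 'M[R]_(s, n)) (dm : 'cV[R]_m) (dp : 'cV[R]_s)
    (z : 'cV[R]_m * 'cV[R]_s) : R :=
  maximum (feasibleQ X Y dm dp z).

Lemma maximumP (R : realType) (A : set R) :
  (exists b, is_maximum A b) -> is_maximum A (maximum A).
Proof. by move=> [b Ab]; exact: (getPex (ex_intro _ b Ab)). Qed.

Lemma compact_maximum (R : realType) (n : nat) (K : set (R * 'rV[R]_n))
    (B M : R) :
  closed K -> K !=set0 ->
  (forall p, K p -> 0 <= p.1 <= B /\ forall j, 0 <= p.2 0 j <= M) ->
  exists b, is_maximum (fst @` K) b.
Proof.
move=> cK K0 KB.
have cptK : compact K.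
  apply: (@subclosed_compact _ _
    (`[0, B]%classic `*` [set v : 'rV[R]_n | forall j, `[0, M]%classic (v ord0 j)])).
  - exact: cK.
  - apply: compact_setX; first exact: segment_compact.
    by apply: (@rV_compact _ _ (fun=> `[0, M]%classic)) => _; exact: segment_compact.
  - by move=> p /KB[p1 p2]; split => [|j] /=; rewrite in_itv //=; exact: p2.
have cfst : {within K, continuous (fst : R * 'rV[R]_n -> R)}.
  by apply: continuous_subspaceT => p; exact: cvg_fst.
have [p Kp pmax] := compact_EVT_max K0 cptK cfst.
exists p.1; split; first by exists p; [exact/set_mem|].
by move=> _ [q Kq <-]; apply: pmax; exact/mem_set.
Qed.

Section Existence.
Context (R : realType) (m s n : nat).
Context (X : 'M[R]_(m, n)) (Y : 'M[R]_(s, n)).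
Context (dm : 'cV[R]_m) (dp : 'cV[R]_s) (z : 'cV[R]_m * 'cV[R]_s).
Context (m0 : (0 < m)%N) (X0 : forall i j, 0 < X i j).
Context (Y0 : forall r j, 0 < Y r j).
Context (dm0 : forall i, 0 <= dm i 0) (dp0 : forall r, 0 <= dp r 0).
Context (d0 : (dm, dp) != 0) (Pz : production_set X Y z).

Let T := (R * 'rV[R]_n)%type.

Let continuous_suml (a : 'I_n -> R) :
  continuous (fun p : T => \sum_j p.2 0 j * a j).
Proof.
apply: (@continuous_big _ _ _ _ predT); first exact: add_continuous.
move=> j _ p; apply: cvgM; last exact: cvg_cst.
apply: (@continuous_comp _ _ _ snd (fun v : 'rV[R]_n => v 0 j)).
  exact: cvg_snd.
exact: coord_continuous.
Qed.

Let continuous_affine (a b c : R) :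
  continuous (fun p : T => (a + p.1 * b) * c).
Proof.
move=> p; apply: cvgM; last exact: cvg_cst.
apply: cvgD; first exact: cvg_cst.
by apply: cvgM; [exact: cvg_fst|exact: cvg_cst].
Qed.

Let closed_forall_le k (f g : 'I_k -> T -> R) :
  (forall i, continuous (f i)) -> (forall i, continuous (g i)) ->
  closed [set p | forall i, f i p <= g i p].
Proof.
move=> cf cg.
have -> : [set p | forall i, f i p <= g i p] =
    \bigcap_i ((fun p => g i p - f i p) @^-1` [set x | 0 <= x]).
  apply/seteqP; split => p /= h i; first by move=> _ /=; rewrite subr_ge0.
  by have /= := h i I; rewrite subr_ge0.
apply: closed_bigI => i _; apply: preimage_closed; last exact: closed_ge.
by move=> p _; apply: cvgB; [exact: cg|exact: cf].
Qed.

Let M : R := \sum_j z.1 (Ordinal m0) 0 / X (Ordinal m0) j.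

Let z1_gt0 i : 0 < z.1 i 0. Proof. by case: Pz. Qed.

Let z2_gt0 r : 0 < z.2 r 0. Proof. by case: Pz. Qed.

Let M_summand_ge0 j : 0 <= z.1 (Ordinal m0) 0 / X (Ordinal m0) j.
Proof. by rewrite divr_ge0 ?ltW ?z1_gt0. Qed.

Let term_le_sum k (a : 'I_k -> R) j : (forall j, 0 <= a j) -> a j <= \sum_j a j.
Proof. by move=> a0; rewrite (bigD1 j)//= lerDl sumr_ge0. Qed.

Let input_bound (b : R) (lam : 'I_n -> R) : 0 <= b -> (forall j, 0 <= lam j) ->
  (forall i, \sum_j lam j * X i j <= (1 + b * - dm i 0) * z.1 i 0) ->
  (forall i, b * dm i 0 <= 1) /\ (forall j, lam j <= M).
Proof.
move=> b0 lam0 h.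
have lX0 i j : 0 <= lam j * X i j by exact: mulr_ge0 (lam0 j) (ltW (X0 i j)).
split=> [i|j].
  have := le_trans (sumr_ge0 _ (fun j _ => lX0 i j)) (h i).
  by rewrite pmulr_lge0// mulrN subr_ge0.
apply: le_trans (term_le_sum j M_summand_ge0).
rewrite ler_pdivlMr//; apply: le_trans (term_le_sum j (lX0 _)) _.
apply: le_trans (h _) _; rewrite ger_pMl//.
by rewrite gerDl mulrN oppr_le0 mulr_ge0.
Qed.

Let beta_bound (C : R) : exists B, forall b, 0 <= b ->
  (forall i, b * dm i 0 <= 1) -> (forall r, b * dp r 0 <= C) -> b <= B.
Proof.
have [[i di]|[r dr]] : (exists i, dm i 0 != 0) \/ (exists r, dp r 0 != 0).
  apply: contrapT => /not_orP[h1 h2]; move/eqP: d0; apply.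
  congr pair; apply/matrixP => i j; rewrite ord1 mxE; apply/eqP;
    rewrite -[_ == _]negbK; apply/negP => hi; [apply: h1|apply: h2]; by exists i.
- exists (1 / dm i 0) => b _ /(_ i) h _.
  by rewrite ler_pdivlMr// lt_neqAle eq_sym di dm0.
- exists (C / dp r 0) => b _ _ /(_ r) h.
  by rewrite ler_pdivlMr// lt_neqAle eq_sym dr dp0.
Qed.

Lemma betaL_is_maximum :
  is_maximum (feasibleL X Y dm dp z) (betaL X Y dm dp z).
Proof.
apply: maximumP.
pose K : set T := [set p |
  [set p : T | forall _ : 'I_1, 0 <= (0 + p.1 * 1) * 1] p /\
  [set p : T | forall j, 0 <= \sum_k p.2 0 k * (k == j)%:R] p /\
  [set p : T | forall i, \sum_j p.2 0 j * X i j
                         <= (1 + p.1 * - dm i 0) * z.1 i 0] p /\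
  [set p : T | forall r, (1 + p.1 * dp r 0) * z.2 r 0
                         <= \sum_j p.2 0 j * Y r j] p].
have cK : closed K.
  do !apply: closedI; apply: closed_forall_le => i //; by move=> p; exact: cvg_cst.
have sumE (p : T) j : \sum_k p.2 0 k * (k == j)%:R = p.2 0 j.
  rewrite (bigD1 j)//= eqxx mulr1 big1 ?addr0// => k /negPf ->.
  by rewrite mulr0.
have KE (p : T) : K p <-> [/\ 0 <= p.1, forall j, 0 <= p.2 0 j,
  forall i, \sum_j p.2 0 j * X i j <= (1 + p.1 * - dm i 0) * z.1 i 0 &
  forall r, (1 + p.1 * dp r 0) * z.2 r 0 <= \sum_j p.2 0 j * Y r j].
  split=> [[/= h1 [h2 [h3 h4]]]|[h1 h2 h3 h4]].
    split=> //; first by have := h1 ord0; rewrite add0r !mulr1.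
    by move=> j; have := h2 j; rewrite sumE.
  split; first by move=> _ /=; rewrite add0r !mulr1.
  by split=> // j; rewrite sumE.
have FE : feasibleL X Y dm dp z = fst @` K.
  apply/seteqP; split=> b /=.
    move=> [b0 [lam [l0 lX lY]]]; exists (b, lam^T) => //; apply/KE; split => //=.
    - by move=> j; rewrite mxE.
    - move=> i; have := lX i; rewrite subr_le0 mulrN; congr (_ <= _).
      by apply: eq_bigr => j _; rewrite mxE.
    - move=> r; have := lY r; rewrite subr_ge0; congr (_ <= _).
      by apply: eq_bigr => j _; rewrite mxE.
  move=> [[b' lam] /KE[/= b0 l0 lX lY] <-]; split=> //; exists lam^T; split.
  - by move=> j; rewrite mxE.
  - move=> i; have := lX i; rewrite subr_le0 mulrN; congr (_ <= _).
    by apply: eq_bigr => j _; rewrite mxE.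
  - move=> r; have := lY r; rewrite subr_ge0; congr (_ <= _).
    by apply: eq_bigr => j _; rewrite mxE.
rewrite FE.
have C0 r : 0 <= (\sum_j M * Y r j) / z.2 r 0.
  apply: divr_ge0; last exact: ltW.
  apply: sumr_ge0 => j _; apply: mulr_ge0; last exact: ltW.
  by apply: sumr_ge0 => ? _; exact: M_summand_ge0.
have [B hB] := beta_bound (\sum_r (\sum_j M * Y r j) / z.2 r 0).
apply: (@compact_maximum _ _ _ B M) => //.
- case: Pz => _ _ [lam [l0 lX lY]]; exists (0, lam^T); apply/KE; split=> //=.
  + by move=> j; rewrite mxE.
  + move=> i; rewrite mul0r addr0 mul1r; have := lX i; rewrite mxE.
    by congr (_ <= _); apply: eq_bigr => j _; rewrite mxE mulrC.
  + move=> r; rewrite mul0r addr0 mul1r; have := lY r; rewrite mxE.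
    by congr (_ <= _); apply: eq_bigr => j _; rewrite mxE mulrC.
- move=> p /KE[b0 l0 lX lY].
  have [hm hl] := input_bound b0 l0 lX.
  split; last by move=> j; rewrite l0 hl.
  rewrite b0/=; apply: hB => // r; apply: le_trans (term_le_sum r C0).
  rewrite ler_pdivlMr//; apply: (@le_trans _ _ (\sum_j p.2 0 j * Y r j)).
    by apply: le_trans (lY r); rewrite mulrDl mul1r lerDr ltW.
  by apply: ler_sum => j _; rewrite ler_wpM2r// ltW.
Qed.

Lemma betaQ_is_maximum :
  is_maximum (feasibleQ X Y dm dp z) (betaQ X Y dm dp z).
Proof.
apply: maximumP.
pose K : set T := [set p |
  [set p : T | forall _ : 'I_1, 0 <= (0 + p.1 * 1) * 1] p /\
  [set p : T | forall j, 0 <= \sum_k p.2 0 k * (k == j)%:R] p /\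
  [set p : T | forall r, 0 <= (1 + p.1 * - dp r 0) * 1] p /\
  [set p : T | forall i, \sum_j p.2 0 j * X i j
                         <= (1 + p.1 * - dm i 0) * z.1 i 0] p /\
  [set p : T | forall r, z.2 r 0 <=
    ((1 + p.1 * - dp r 0) * 1) * \sum_j p.2 0 j * Y r j] p].
have cK : closed K.
  do !apply: closedI; apply: closed_forall_le => i //; try by move=> p; exact: cvg_cst.
  by move=> p; apply: cvgM; [exact: continuous_affine|exact: continuous_suml].
have sumE (p : T) j : \sum_k p.2 0 k * (k == j)%:R = p.2 0 j.
  rewrite (bigD1 j)//= eqxx mulr1 big1 ?addr0// => k /negPf ->.
  by rewrite mulr0.
have KE (p : T) : K p <-> [/\ 0 <= p.1, forall j, 0 <= p.2 0 j,
  forall r, p.1 * dp r 0 < 1,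
  forall i, \sum_j p.2 0 j * X i j <= (1 + p.1 * - dm i 0) * z.1 i 0 &
  forall r, (1 - p.1 * dp r 0)^-1 * z.2 r 0 <= \sum_j p.2 0 j * Y r j].
  split=> [[/= h1 [h2 [h3 [h4 h5]]]]|[h1 h2 h3 h4 h5]].
    have lt1 r : p.1 * dp r 0 < 1.
      have := h3 r; rewrite mulr1 mulrN le_eqVlt subr_gt0 => /orP[/eqP e|//].
      have := h5 r; rewrite mulr1 mulrN -e mul0r.
      by rewrite leNgt z2_gt0.
    split=> //; first by have := h1 ord0; rewrite add0r !mulr1.
    + by move=> j; have := h2 j; rewrite sumE.
    + move=> r; rewrite mulrC ler_pdivrMr ?subr_gt0// mulrC.
      by have := h5 r; rewrite mulr1 mulrN.
  split; first by move=> _ /=; rewrite add0r !mulr1.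
  split; first by move=> j; rewrite sumE.
  split; first by move=> r; rewrite mulr1 mulrN subr_ge0 ltW.
  split=> // r; have := h5 r; rewrite mulrC ler_pdivrMr ?subr_gt0// mulrC.
  by rewrite mulr1 mulrN.
have FE : feasibleQ X Y dm dp z = fst @` K.
  apply/seteqP; split=> b /=.
    move=> [b0 [lam [l0 l1 lX lY]]]; exists (b, lam^T) => //; apply/KE; split => //=.
    - by move=> j; rewrite mxE.
    - move=> i; have := lX i; rewrite subr_le0 mulrN; congr (_ <= _).
      by apply: eq_bigr => j _; rewrite mxE.
    - move=> r; have := lY r; rewrite subr_ge0; congr (_ <= _).
      by apply: eq_bigr => j _; rewrite mxE.
  move=> [[b' lam] /KE[/= b0 l0 l1 lX lY] <-]; split=> //; exists lam^T; split=> //.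
  - by move=> j; rewrite mxE.
  - move=> i; have := lX i; rewrite subr_le0 mulrN; congr (_ <= _).
    by apply: eq_bigr => j _; rewrite mxE.
  - move=> r; have := lY r; rewrite subr_ge0; congr (_ <= _).
    by apply: eq_bigr => j _; rewrite mxE.
rewrite FE.
have [B hB] := beta_bound 1.
apply: (@compact_maximum _ _ _ B M) => //.
- case: Pz => _ _ [lam [l0 lX lY]]; exists (0, lam^T); apply/KE; split=> //=.
  + by move=> j; rewrite mxE.
  + by move=> r; rewrite mul0r.
  + move=> i; rewrite mul0r addr0 mul1r; have := lX i; rewrite mxE.
    by congr (_ <= _); apply: eq_bigr => j _; rewrite mxE mulrC.
  + move=> r; rewrite mul0r subr0 invr1 mul1r; have := lY r; rewrite mxE.
    by congr (_ <= _); apply: eq_bigr => j _; rewrite mxE mulrC.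
- move=> p /KE[b0 l0 l1 lX lY].
  have [hm hl] := input_bound b0 l0 lX.
  split; last by move=> j; rewrite l0 hl.
  by rewrite b0/=; apply: hB => // r; exact: ltW.
Qed.

End Existence.

(* Main.v *)
Require Import Defs.
From mathcomp Require Import all_boot all_order all_algebra.
From mathcomp Require Import all_classical all_reals all_analysis.

Set Implicit Arguments.
Unset Strict Implicit.
Unset Printing Implicit Defensive.

Import Order.TTheory GRing.Theory Num.Theory.
Import numFieldNormedType.Exports.

Local Open Scope classical_set_scope.
Local Open Scope ring_scope.

(** Raising an input, or lowering an output, relaxes the constraints of both
models: the input bounds carry the factors 1 - b d-, which are non-negative at
every feasible b because they dominate a non-negative combination of inputs,
and the output bounds carry the factors 1 + b d+ or 1 / (1 - b d+), which are
non-negative as well.  Such a move therefore enlarges the feasible set of b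
([feasibleL_mono], [feasibleQ_mono]), and it stays inside the production set.
Since the maxima are attained there, the optimal value cannot decrease
([beta_mono]).

The increments of beta are thus controlled on one side of the point only: for
positive steps along an input, and for small negative steps along an output,
small enough to keep that output positive.  This is enough, because a
two-sided derivative is also the limit of the difference quotients along
either one-sided filter. *)

(** * Sign of a directional derivative from one-sided increments *)

Section DirectionalDerivative.
Context (R : realType) (V : normedModType R) (f : V -> R) (a v : V).
Context (df : derivable f a v).

Lemma derive_ge0_right :
  (\forall h \near 0^'+, f a <= f (h *: v + a)) -> 0 <= 'D_v f a.
Proof.
move=> fa.
have cq := cvg_dnbhs_at_right df.
rewrite /derive -(cvg_lim _ cq)//; apply: limr_ge; first exact: cvgP cq.
near=> h; have h0 : 0 < h by near: h; exact: nbhs_right_gt.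
rewrite /= -[_ *: _]/(_ * _) pmulr_rge0 ?invr_gt0// subr_ge0.
by near: h.
Unshelve. all: by end_near. Qed.

Lemma derive_le0_left :
  (\forall h \near 0^'-, f a <= f (h *: v + a)) -> 'D_v f a <= 0.
Proof.
move=> fa.
have cq := cvg_dnbhs_at_left df.
rewrite /derive -(cvg_lim _ cq)//; apply: limr_le; first exact: cvgP cq.
near=> h; have h0 : h < 0 by near: h; exact: nbhs_left_lt.
rewrite /= -[_ *: _]/(_ * _) nmulr_rle0 ?invr_lt0// subr_ge0.
by near: h.
Unshelve. all: by end_near. Qed.

End DirectionalDerivative.

(** * Monotonicity of the optimal values *)

Lemma is_maximum_le (R : realType) (A B : set R) (a b : R) :
  is_maximum A a -> is_maximum B b -> A `<=` B -> a <= b.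
Proof. by move=> [Aa _] [_ Bb] AB; exact/Bb/AB. Qed.

(** The common input constraint: the coefficient of [u] is non-negative as soon
as the constraint holds at a positive [u], so it survives an increase of [u]. *)
Lemma input_constraint_mono (R : realType) (S c u u' : R) :
  0 <= S -> 0 < u -> u <= u' -> S - c * u <= 0 -> S - c * u' <= 0.
Proof.
rewrite !subr_le0 => S0 u0 uu' Scu.
have c0 : 0 <= c by rewrite -(pmulr_lge0 _ u0) (le_trans S0).
exact: le_trans Scu (ler_wpM2l c0 uu').
Qed.

Lemma output_constraint_mono (R : realType) (S c u u' : R) :
  0 <= c -> u' <= u -> 0 <= S - c * u -> 0 <= S - c * u'.
Proof. by rewrite !subr_ge0 => c0 uu'; apply: le_trans; exact: ler_wpM2l. Qed.

Section Monotonicity.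
Context (R : realType) (m s n : nat).
Context (X : 'M[R]_(m, n)) (Y : 'M[R]_(s, n)).
Context (dm : 'cV[R]_m) (dp : 'cV[R]_s).

(** The Pareto dominance of efficiency analysis, [z] being the dominating
unit. *)
Definition dominated (z' z : 'cV[R]_m * 'cV[R]_s) :=
  (forall i, z.1 i 0 <= z'.1 i 0) /\ (forall r, z'.2 r 0 <= z.2 r 0).

(** Free disposability, for as long as the outputs stay positive. *)
Lemma production_set_mono z z' : dominated z' z -> (forall r, 0 < z'.2 r 0) ->
  production_set X Y z -> production_set X Y z'.
Proof.
move=> [le1 le2] z'0 [z10 z20 [lam [lam0 lX lY]]]; split=> //.
  by move=> i; exact: lt_le_trans (le1 i).
by exists lam; split=> // [i|r]; [exact: le_trans (le1 i)|
  exact: le_trans (lY r)].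
Qed.

Context (X_gt0 : forall i j, 0 < X i j).

Let input_ge0 (lam : 'cV[R]_n) i :
  (forall j, 0 <= lam j 0) -> 0 <= \sum_(j < n) lam j 0 * X i j.
Proof. by move=> lam0; apply: sumr_ge0 => j _; rewrite mulr_ge0// ltW. Qed.

Lemma feasibleQ_mono z z' : dominated z' z -> (forall i, 0 < z.1 i 0) ->
  feasibleQ X Y dm dp z `<=` feasibleQ X Y dm dp z'.
Proof.
move=> [le1 le2] z0 b [b0 [lam [lam0 bdp lX lY]]]; split=> //.
exists lam; split=> // [i|r].
  by apply: input_constraint_mono (lX i); rewrite ?input_ge0.
by apply: output_constraint_mono (lY r); rewrite ?invr_ge0 ?subr_ge0// ltW.
Qed.

Context (dp_ge0 : forall r, 0 <= dp r 0).

Lemma feasibleL_mono z z' : dominated z' z -> (forall i, 0 < z.1 i 0) ->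
  feasibleL X Y dm dp z `<=` feasibleL X Y dm dp z'.
Proof.
move=> [le1 le2] z0 b [b0 [lam [lam0 lX lY]]]; split=> //.
exists lam; split=> // [i|r].
  by apply: input_constraint_mono (lX i); rewrite ?input_ge0.
by apply: output_constraint_mono (lY r); rewrite ?addr_ge0 ?mulr_ge0.
Qed.

Context (m_gt0 : (0 < m)%N) (Y_gt0 : forall r j, 0 < Y r j).
Context (dm_ge0 : forall i, 0 <= dm i 0) (d_neq0 : (dm, dp) != 0).

Lemma beta_mono (beta : 'cV[R]_m * 'cV[R]_s -> R)
    (betaE : (forall z, production_set X Y z -> beta z = betaL X Y dm dp z) \/
             (forall z, production_set X Y z -> beta z = betaQ X Y dm dp z))
    z z' : dominated z' z -> (forall r, 0 < z'.2 r 0) ->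
  production_set X Y z -> beta z <= beta z'.
Proof.
move=> zz' z'0 Pz; have Pz' := production_set_mono zz' z'0 Pz.
have z0 : forall i, 0 < z.1 i 0 by case: Pz.
case: betaE => bE; rewrite !bE//.
  by apply: is_maximum_le (feasibleL_mono zz' z0); exact: betaL_is_maximum.
by apply: is_maximum_le (feasibleQ_mono zz' z0); exact: betaQ_is_maximum.
Qed.

End Monotonicity.

(* [beta] is only constrained on [production_set X Y].  At a boundary point its
   values outside are arbitrary, so the quantification over [beta] covers every
   derivative taken within the set (extend [beta] affinely along the line).
   The maxima are piecewise smooth in general, hence [derivable]. *)
Theorem proposition5p1 (R : realType) (m s n : nat)
    (X : 'M[R]_(m, n)) (Y : 'M[R]_(s, n))
    (dm : 'cV[R]_m) (dp : 'cV[R]_s)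
    (beta : 'cV[R]_m * 'cV[R]_s -> R)
    (m_gt0 : (0 < m)%N) (s_gt0 : (0 < s)%N) (n_gt0 : (0 < n)%N)
    (X_gt0 : forall i j, 0 < X i j) (Y_gt0 : forall r j, 0 < Y r j)
    (dm_ge0 : forall i, 0 <= dm i 0) (dp_ge0 : forall r, 0 <= dp r 0)
    (d_neq0 : (dm, dp) != 0)
    (betaE : (forall z, production_set X Y z -> beta z = betaL X Y dm dp z) \/
             (forall z, production_set X Y z -> beta z = betaQ X Y dm dp z))
    (x : 'cV[R]_m) (y : 'cV[R]_s) (Pxy : production_set X Y (x, y)) :
  (forall i : 'I_m,
     derivable beta (x, y) (delta_mx i 0, 0) ->
     'D_(delta_mx i 0, 0) beta (x, y) >= 0) /\
  (forall r : 'I_s,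
     derivable beta (x, y) (0, delta_mx r 0) ->
     'D_(0, delta_mx r 0) beta (x, y) <= 0).
Proof.
have [_ /= y_gt0 _] := Pxy.
have mono := beta_mono X_gt0 dp_ge0 m_gt0 Y_gt0 dm_ge0 d_neq0 betaE.
split=> [i|r] dbeta.
- apply: derive_ge0_right => //; near=> h.
  have h_gt0 : 0 < h by near: h; exact: nbhs_right_gt.
  apply: mono => //=; last by move=> r; rewrite !mxE mulr0 add0r.
  split=> /= k; rewrite !mxE; last by rewrite mulr0 add0r.
  by rewrite lerDr mulr_ge0// ltW.
- apply: derive_le0_left => //; near=> h.
  have h_lt0 : h < 0 by near: h; exact: nbhs_left_lt.
  have h_gtNy : - y r 0 < h by near: h; apply: nbhs_left_gt; rewrite oppr_lt0.
  apply: mono => //=.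
    split=> /= k; rewrite !mxE; first by rewrite mulr0 add0r.
    by rewrite gerDr mulr_le0_ge0// ltW.
  move=> k; rewrite !mxE eqxx andbT; have [->|_] := eqVneq k r.
    by rewrite mulr1 -ltrBlDr sub0r.
  by rewrite mulr0 add0r.
Unshelve. all: by end_near. Qed.
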